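(* Let $F_m$ denote the $m$-th Fibonacci polynomial. 1. For any odd number $s\in 1+2\mathbb{Z}_2$ and any positive integer $l$, $F_{3\cdot 2^l}(s)\equiv 0 \pmod{2^{l+2}}$ and $F_{3\cdot 2^l+1}(s)\equiv 1+2^{l+1} \pmod{2^{l+2}}$. 2. For any odd number $s\in 1+2\mathbb{Z}_2$ and any positive integer $l$, the sequence $\{F_m(s) \bmod 2^l\}_{m\ge 0}$ is periodic of period $3\cdot 2^{l-1}$. 3. For any even number $s\in 2\mathbb{Z}_2$ and any positive integer $l$, the sequence $\{F_m(s) \bmod 2^l\}_{m\ge 0}$ is periodic of period $2$ if $l\le \nu_2(s)$ and periodic of period $2^{l+1-\nu_2(s)}$ if $l>\nu_2(s)$.
   Context: $\mathbb{Z}_2$ is the ring of 2-adic integers and $\nu_2$ the 2-adic valuation (with $\nu_2(0)=\infty$). The Fibonacci polynomials are defined by $F_0(x)=0$, $F_1(x)=1$, $F_m(x)=xF_{m-1}(x)+F_{m-2}(x)$ for $m\ge 2$. A sequence $\{f_m\}_{m\ge 0}$ is called periodic of period $d$ if $d$ is the least positive integer such that $f_{m+d}=f_m$ for every $m$. *)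

(* Defs.v *)
From HB Require Import structures.
From mathcomp Require Import all_boot all_order all_algebra.
From mathcomp Require Import boolp classical_sets.

Set Implicit Arguments.
Unset Strict Implicit.
Unset Printing Implicit Defensive.

Import Order.TTheory GRing.Theory Num.Theory.

Local Open Scope ring_scope.

(* The 2-adic integers, as the inverse limit of the rings Z / 2^n Z: [x n] is *)
(* the representative of x modulo 2 ^ n lying in {0, ..., 2 ^ n - 1}.          *)
Record Z2 : Type := MkZ2 {
  z2rep :> nat -> int;
  z2repP : forall n, z2rep n = (z2rep n.+1 %% 2 ^+ n)%Z }.

Lemma z2P (x y : Z2) : (forall n, x n = y n) -> x = y.
Proof.
case: x y => [x Hx] [y Hy] /= /funext exy; subst y.
by congr MkZ2; apply: Prop_irrelevance.
Qed.

Lemma z2_mod (x : Z2) n : (x n %% 2 ^+ n)%Z = x n.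
Proof. by rewrite z2repP modz_mod. Qed.

Lemma modz_exp2S (a : int) n : ((a %% 2 ^+ n.+1)%Z %% 2 ^+ n)%Z = (a %% 2 ^+ n)%Z.
Proof.
by rewrite {2}(divz_eq a (2 ^+ n.+1)) exprS mulrA modzMDl.
Qed.

Lemma z2_of_int_subproof (a : int) n :
  (a %% 2 ^+ n)%Z = ((a %% 2 ^+ n.+1)%Z %% 2 ^+ n)%Z.
Proof. by rewrite modz_exp2S. Qed.

Definition z2_of_int (a : int) : Z2 := MkZ2 (z2_of_int_subproof a).

Lemma z2_opp_subproof (x : Z2) n :
  (- x n %% 2 ^+ n)%Z = ((- x n.+1 %% 2 ^+ n.+1)%Z %% 2 ^+ n)%Z.
Proof. by rewrite modz_exp2S (z2repP x n) modzNm. Qed.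

Definition z2_opp (x : Z2) : Z2 := MkZ2 (z2_opp_subproof x).

Lemma z2_add_subproof (x y : Z2) n :
  ((x n + y n) %% 2 ^+ n)%Z = (((x n.+1 + y n.+1) %% 2 ^+ n.+1)%Z %% 2 ^+ n)%Z.
Proof. by rewrite modz_exp2S (z2repP x n) (z2repP y n) modzDm. Qed.

Definition z2_add (x y : Z2) : Z2 := MkZ2 (z2_add_subproof x y).

Lemma z2_mul_subproof (x y : Z2) n :
  ((x n * y n) %% 2 ^+ n)%Z = (((x n.+1 * y n.+1) %% 2 ^+ n.+1)%Z %% 2 ^+ n)%Z.
Proof. by rewrite modz_exp2S (z2repP x n) (z2repP y n) modzMm. Qed.

Definition z2_mul (x y : Z2) : Z2 := MkZ2 (z2_mul_subproof x y).

HB.instance Definition _ := gen_eqMixin Z2.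
HB.instance Definition _ := gen_choiceMixin Z2.

Lemma z2_addA : associative z2_add.
Proof. by move=> x y z; apply: z2P => n /=; rewrite modzDml modzDmr addrA. Qed.

Lemma z2_addC : commutative z2_add.
Proof. by move=> x y; apply: z2P => n /=; rewrite addrC. Qed.

Lemma z2_add0 : left_id (z2_of_int 0) z2_add.
Proof. by move=> x; apply: z2P => n /=; rewrite modzDml add0r z2_mod. Qed.

Lemma z2_addN : left_inverse (z2_of_int 0) z2_opp z2_add.
Proof. by move=> x; apply: z2P => n /=; rewrite modzDml addNr. Qed.

HB.instance Definition _ :=
  GRing.isZmodule.Build Z2 z2_addA z2_addC z2_add0 z2_addN.

Lemma z2_mulA : associative z2_mul.
Proof. by move=> x y z; apply: z2P => n /=; rewrite modzMml modzMmr mulrA. Qed.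

Lemma z2_mulC : commutative z2_mul.
Proof. by move=> x y; apply: z2P => n /=; rewrite mulrC. Qed.

Lemma z2_mul1 : left_id (z2_of_int 1) z2_mul.
Proof. by move=> x; apply: z2P => n /=; rewrite modzMml mul1r z2_mod. Qed.

Lemma z2_mulDl : left_distributive z2_mul z2_add.
Proof.
by move=> x y z; apply: z2P => n /=; rewrite modzMml modzDm mulrDl.
Qed.

Lemma z2_oner_neq0 : z2_of_int 1 != 0.
Proof. by apply/eqP => /(congr1 (fun x : Z2 => x 1%N)). Qed.

HB.instance Definition _ := GRing.Zmodule_isComNzRing.Build Z2
  z2_mulA z2_mulC z2_mul1 z2_mulDl z2_oner_neq0.

Definition z2_odd (s : Z2) : Prop := exists t : Z2, s = 1 + 2 * t.

Definition z2_even (s : Z2) : Prop := exists t : Z2, s = 2 * t.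

Definition pow2_dvd (k : nat) (x : Z2) : Prop := exists z : Z2, x = 2 ^+ k * z.

Definition z2_congr (k : nat) (x y : Z2) : Prop := pow2_dvd k (x - y).

(* The element x mod 2 ^ k of Z2 / 2 ^ k Z2, as the coset x + 2 ^ k Z2. *)
Definition z2_mod_pow2 (k : nat) (x : Z2) : set Z2 :=
  [set y | z2_congr k y x]%classic.

(* The 2-adic valuation; [None] stands for infinity. *)
Definition nu2 (s : Z2) : option nat :=
  if s == 0 then None
  else Some (xget 0%N [set k | pow2_dvd k s /\ ~ pow2_dvd k.+1 s]%classic).

Definition le_nu2 (l : nat) (s : Z2) : Prop :=
  if nu2 s is Some v then (l <= v)%N else True.

Lemma z2_coefD (x y : Z2) n : (x + y) n = ((x n + y n) %% 2 ^+ n)%Z.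
Proof. by []. Qed.

Lemma z2_coefM (x y : Z2) n : (x * y) n = ((x n * y n) %% 2 ^+ n)%Z.
Proof. by []. Qed.

Lemma z2_natE (m n : nat) : (m%:R : Z2) n = (m%:Z %% 2 ^+ n)%Z.
Proof.
elim: m => [|m IH] //.
by rewrite -addn1 natrD z2_coefD IH modzDml modzDmr PoszD.
Qed.

Lemma z2_repD (x : Z2) n k : (x (n + k)%N %% 2 ^+ n)%Z = x n.
Proof.
elim: k => [|k IH]; first by rewrite addn0 z2_mod.
rewrite -IH (z2repP x (n + k)) addnS.
rewrite {1}(divz_eq (x (n + k).+1) (2 ^+ (n + k))).
by rewrite exprD [2 ^+ n * _]mulrC mulrA modzMDl.
Qed.

Lemma pow2_dvdE k (x : Z2) : pow2_dvd k x <-> x k = 0.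
Proof.
have E m n : (2 ^+ m : Z2) n = (2 ^+ m %% 2 ^+ n)%Z.
  by rewrite -natrX z2_natE -natz natrX.
split=> [[z ->]|xk0]; first by rewrite z2_coefM E modzz mul0r mod0z.
have xD n : (2 ^+ k %| x (n + k)%N)%Z.
  by apply/dvdz_mod0P; rewrite addnC z2_repD.
have p0 : (2 ^+ k : int) != 0 by rewrite expf_neq0.
have zP n : (x (n + k)%N %/ 2 ^+ k)%Z = ((x (n.+1 + k)%N %/ 2 ^+ k)%Z %% 2 ^+ n)%Z.
  apply: (mulIf p0); rewrite divzK // (z2repP x (n + k)) exprD.
  rewrite -{1}(divzK (xD n.+1)) [_ * 2 ^+ k in LHS]mulrC [_ * 2 ^+ k]mulrC /modz divzMpl ?exprn_gt0 //.
  by rewrite mulrBl -[in RHS]mulrA [2 ^+ n * 2 ^+ k]mulrC [2 ^+ k * (_ %/ _)%Z]mulrC.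
exists (MkZ2 zP); apply: z2P => n.
rewrite z2_coefM E /= modzMml mulrC divzK //.
by rewrite z2_repD.
Qed.

Lemma nu2_None s : nu2 s = None <-> s = 0.
Proof. by rewrite /nu2; case: eqP. Qed.

Lemma nu2_Some s v : nu2 s = Some v <-> pow2_dvd v s /\ ~ pow2_dvd v.+1 s.
Proof.
have dvdW i j : (i <= j)%N -> pow2_dvd j s -> pow2_dvd i s.
  by move=> /subnK <- [z ->]; exists (2 ^+ (j - i) * z); rewrite mulrA -exprD addnC.
have uniq i j : pow2_dvd i s /\ ~ pow2_dvd i.+1 s ->
    pow2_dvd j s /\ ~ pow2_dvd j.+1 s -> i = j.
  move=> [i1 i2] [j1 j2]; case: (ltngtP i j) => // ij.
  - by case: i2; apply: dvdW j1.
  - by case: j2; apply: dvdW i1.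
rewrite /nu2; case: eqP => [->|/eqP s0].
  by split=> // -[_ []]; exists 0; rewrite mulr0.
have [k sk] : exists k, ~ pow2_dvd k s.
  apply: contrapT => /forallNP h; move/eqP: s0; apply; apply: z2P => n.
  have /pow2_dvdE -> : pow2_dvd n s by apply: contrapT; apply: h.
  by rewrite (_ : (0 : Z2) n = (0 %% 2 ^+ n)%Z) // mod0z.
have [w Pw] : exists w, pow2_dvd w s /\ ~ pow2_dvd w.+1 s.
  elim: k sk => [|k IH] sk; first by case: sk; exists s; rewrite mul1r.
  by have [h|/IH//] := pselect (pow2_dvd k s); exists k.
set P := [set k | _]%classic; have Px : P (xget 0%N P) by apply: (xgetI 0%N (Pw : P w)).
split=> [[<-]//|Pv]; congr Some; exact: uniq.
Qed.

Fixpoint fibp (m : nat) : {poly int} :=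
  match m with
  | 0%N => 0
  | 1%N => 1
  | (m''.+1 as m').+1 => 'X * fibp m' + fibp m''
  end.

Definition fib_eval (m : nat) (s : Z2) : Z2 := (map_poly intr (fibp m)).[s].

Definition periodic_of_period (T : Type) (f : nat -> T) (d : nat) : Prop :=
  [/\ (0 < d)%N,
      forall m, f (m + d)%N = f m
    & forall e, (0 < e)%N -> (forall m, f (m + e)%N = f m) -> (d <= e)%N].

(* Main.v *)
Require Import Defs.
From mathcomp Require Import all_boot all_order all_algebra.
From mathcomp Require Import boolp classical_sets ring zify.

(** The sequence F_m(s) satisfies a linear recurrence whose coefficient of
    F_(m-2) is 1, so it is determined modulo 2^l by two consecutive terms:
    e is a period modulo 2^l exactly when F_e = 0 and F_(e+1) = 1 modulo 2^l
    ([fib_periodP]).  Periods are closed under division with remainder, so a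
    period D is the least one as soon as no D/p, for p a prime divisor of D,
    is a period ([least_periodP]).  Each claim on periods thus reduces to the
    pairs (F_n, F_(n+1)) at n = D and n = D/p.

    These pairs are followed along n, 2n, 4n, ... by the doubling formulas
      F_(2n) = F_n (2 F_(n+1) - s F_n),  F_(2n+1) = F_n^2 + F_(n+1)^2,
    which gain exactly one power of 2 at each step.  For odd s the start is
    n = 6, where s^2 = 1 mod 8 gives F_6 = 0 and F_7 = 5 mod 8
    ([fib_odd_6pow2]).  The congruence F_(n+1) = 1 + 2^(l+1) mod 2^(l+2) at
    n = 3 * 2^l does two things: it makes n a period modulo 2^(l+1), and it
    prevents n from being one modulo 2^(l+2), which excludes D/2; for D = 6
    the half is 3, excluded by F_3 = s^2 + 1 = 2 mod 4.  The quotient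
    D/3 = 2^k is excluded because modulo 2 the sequence is
    0, 1, 1, 0, 1, 1, ... ([fib_odd_period_dvd3]).

    For even s with 2^v dividing s exactly, the start is n = 2, where F_2 = s
    and F_3 = 1 + s^2.  In F_(2n) = 2 F_n (F_(n+1) - (s/2) F_n) the last factor
    is odd, so the valuation of F_(2^(k+1)) is exactly v + k
    ([fib_even_pow2], [fib_even_pow2_ndvd]).  Here 2 is the only prime
    divisor of D, and D/2 is excluded by this valuation.  When 2^l divides s,
    the same start gives the period 2, and 1 is not a period as F_1 is odd. *)

Set Implicit Arguments.
Unset Strict Implicit.
Unset Printing Implicit Defensive.

Import GRing.Theory.

Local Open Scope ring_scope.

(** * Least periods of a sequence *)

Lemma period_mul (T : Type) (f : nat -> T) d q :
  (forall m, f (m + d)%N = f m) -> forall m, f (m + q * d)%N = f m.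
Proof.
move=> fd m; elim: q => [|q IHq]; first by rewrite mul0n addn0.
by rewrite mulSn [(d + _)%N]addnC addnA fd.
Qed.

Lemma period_mod (T : Type) (f : nat -> T) d e :
  (forall m, f (m + d)%N = f m) -> (forall m, f (m + e)%N = f m) ->
  forall m, f (m + e %% d)%N = f m.
Proof.
move=> fd fe m; rewrite -(period_mul (e %/ d) fd (m + e %% d)) -addnA.
by rewrite [(e %% d + _)%N]addnC -divn_eq.
Qed.

(** Every period is a multiple of the least one d, since its remainder modulo d
    is again a period.  If D = d * q with q > 1, then for any prime p dividing q
    the number D/p is a multiple of d, hence a period. *)
Lemma least_periodP (T : Type) (f : nat -> T) D :
  (0 < D)%N -> (forall m, f (m + D)%N = f m) ->
  (forall p, prime p -> (p %| D)%N -> ~ forall m, f (m + D %/ p)%N = f m) ->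
  periodic_of_period f D.
Proof.
move=> D_gt0 fD Dmin.
pose P e := (0 < e)%N && `[< forall m, f (m + e)%N = f m >].
have exP : exists e, P e by exists D; apply/andP; split=> //; apply/asboolP.
case: (ex_minnP exP) => d /andP[d_gt0 /asboolP fd] d_min.
have d_le e : (0 < e)%N -> (forall m, f (m + e)%N = f m) -> (d <= e)%N.
  by move=> e_gt0 fe; apply: d_min; apply/andP; split=> //; apply/asboolP.
suff -> : D = d by split.
have /dvdnP[q Dq] : (d %| D)%N.
  rewrite /dvdn; case: posnP => // r_gt0.
  by have := d_le _ r_gt0 (period_mod fd fD); rewrite leqNgt ltn_mod d_gt0.
have [q1|q_neq1] := eqVneq q 1%N; first by rewrite Dq q1 mul1n.
have p_pr : prime (pdiv q).
  by apply: pdiv_prime; move: D_gt0 q_neq1; rewrite Dq; case: q {Dq} => [|[]].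
case: (Dmin _ p_pr); rewrite Dq; first by rewrite dvdn_mulr // pdiv_dvd.
by rewrite mulnC -muln_divA ?pdiv_dvd // mulnC; exact: period_mul.
Qed.

(** * Divisibility by powers of two *)

Lemma pow2_dvdW j k x : (j <= k)%N -> pow2_dvd k x -> pow2_dvd j x.
Proof.
by move=> /subnKC <- [z ->]; exists (2 ^+ (k - j) * z); rewrite exprD mulrA.
Qed.

Lemma pow2_dvdD k x y : pow2_dvd k x -> pow2_dvd k y -> pow2_dvd k (x + y).
Proof. by move=> [a ->] [b ->]; exists (a + b); rewrite mulrDr. Qed.

Lemma pow2_dvdN k x : pow2_dvd k x -> pow2_dvd k (- x).
Proof. by move=> [a ->]; exists (- a); rewrite mulrN. Qed.

Lemma pow2_dvdMl k x y : pow2_dvd k y -> pow2_dvd k (x * y).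
Proof. by move=> [a ->]; exists (x * a); rewrite mulrCA. Qed.

Lemma pow2_dvdDr k x y : pow2_dvd k x -> pow2_dvd k (x + y) -> pow2_dvd k y.
Proof.
by move=> /pow2_dvdN Nx /(pow2_dvdD Nx); rewrite addrA addNr add0r.
Qed.

(** Cancellation of 2, by which an exact valuation is carried along doublings,
    is read off from the identity
    (2 x) mod 2^(k+1) = 2 (x mod 2^k) between integer representatives. *)
Lemma pow2_dvd_double k x : pow2_dvd k.+1 (2 * x) <-> pow2_dvd k x.
Proof.
have E : (2 * x) k.+1 = 2 * x k.
  by rewrite z2_coefM z2_natE modzMml (z2repP x k) exprS mulz_modr.
rewrite !pow2_dvdE E; split=> [/eqP|->]; last by rewrite mulr0.
by rewrite mulf_eq0 => /orP[//|/eqP].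
Qed.

(** An odd factor can be cancelled without inverting it: if x = 2^k z, then
    x (1 + 2t) = 2^(k+1) t z + x, so one more power of 2 in the product is one
    more in x. *)
Lemma pow2_dvd_oddM k x y : z2_odd y -> pow2_dvd k (x * y) -> pow2_dvd k x.
Proof.
move=> [t ->]; elim: k => [|k IHk] dv; first by exists x; rewrite mul1r.
have [z xz] := IHk (pow2_dvdW (leqnSn k) dv).
have E : x * (1 + 2 * t) = 2 ^+ k.+1 * (t * z) + x by rewrite xz exprS; ring.
by rewrite E in dv; apply: pow2_dvdDr dv; exists (t * z).
Qed.

Lemma pow2_ndvd k y : z2_odd y -> ~ pow2_dvd k.+1 (2 ^+ k * y).
Proof.
move=> y_odd /(pow2_dvd_oddM y_odd); elim: k => [|k IHk].
  by move/pow2_dvdE.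
by rewrite exprS => /pow2_dvd_double.
Qed.

(** Decided on the residue of t modulo 2, which is 0 or 1. *)
Lemma mul_succ_even (t : Z2) : z2_even (t * (t + 1)).
Proof.
suff [z ->] : pow2_dvd 1 (t * (t + 1)) by exists z.
have -> : t * (t + 1) = t * t + t by ring.
apply/pow2_dvdE; rewrite z2_coefD z2_coefM modzDml -[t 1%N]z2_mod expr1.
have: (0 <= t 1%N %% 2 < 2)%Z by rewrite modz_ge0 // ltz_pmod.
by case: (t 1%N %% 2)%Z => [[|[|n]]|n].
Qed.

Lemma odd_sqr (s : Z2) : z2_odd s -> exists c, s ^+ 2 = 1 + 8 * c.
Proof.
move=> [t ->]; have [c tc] := mul_succ_even t; exists c.
have -> : (1 + 2 * t) ^+ 2 = 1 + 4 * (t * (t + 1)) by ring.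
by rewrite tc; ring.
Qed.

(** * Fibonacci polynomials *)

Lemma fib_eval0 s : fib_eval 0 s = 0.
Proof. by rewrite /fib_eval /= rmorph0 horner0. Qed.

Lemma fib_eval1 s : fib_eval 1 s = 1.
Proof. by rewrite /fib_eval /= rmorph1 hornerC. Qed.

Lemma fib_evalSS m s : fib_eval m.+2 s = s * fib_eval m.+1 s + fib_eval m s.
Proof.
rewrite /fib_eval [fibp m.+2]/= rmorphD rmorphM /= map_polyX hornerD.
by rewrite mulrC hornerMX mulrC.
Qed.

Lemma fib_eval_add m n s : fib_eval (m + n).+1 s =
  fib_eval m.+1 s * fib_eval n.+1 s + fib_eval m s * fib_eval n s.
Proof.
elim: m n => [|m IHm] n.
  by rewrite add0n fib_eval0 fib_eval1 mul1r mul0r addr0.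
by rewrite addSnnS IHm !fib_evalSS; ring.
Qed.

(** The factor F_(n-1) + F_(n+1) of F_(2n) is written 2 F_(n+1) - s F_n to avoid
    the predecessor of n. *)
Lemma fib_eval_double n s : fib_eval (2 * n) s =
  fib_eval n s * (2 * fib_eval n.+1 s - s * fib_eval n s).
Proof.
case: n => [|n]; first by rewrite muln0 !fib_eval0 mul0r.
by rewrite mul2n -addnn addSn fib_eval_add fib_evalSS; ring.
Qed.

Lemma fib_eval_doubleS n s : fib_eval (2 * n).+1 s =
  fib_eval n s ^+ 2 + fib_eval n.+1 s ^+ 2.
Proof. by rewrite mul2n -addnn fib_eval_add; ring. Qed.

(** * Periods modulo a power of two *)

Lemma z2_mod_pow2E k x y :
  z2_mod_pow2 k x = z2_mod_pow2 k y <-> pow2_dvd k (x - y).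
Proof.
split=> [E|dv].
  have : z2_mod_pow2 k x x by exists 0; rewrite subrr mulr0.
  by rewrite E.
apply/seteqP; split=> z; rewrite /z2_mod_pow2 /= /z2_congr => dz.
  by have := pow2_dvdD dz dv; rewrite addrA subrK.
by have := pow2_dvdD dz (pow2_dvdN dv); rewrite opprB addrA subrK.
Qed.

(** The initial values F_0 = 0 and F_1 = 1 give one direction; the addition
    formula F_(m+1+e) = F_(m+1) F_(e+1) + F_m F_e gives the other. *)
Lemma fib_periodP l s e :
  (forall m, z2_mod_pow2 l (fib_eval (m + e) s) = z2_mod_pow2 l (fib_eval m s))
  <-> pow2_dvd l (fib_eval e s) /\ pow2_dvd l (fib_eval e.+1 s - 1).
Proof.
split=> [per|[d0 d1] m].
  have /z2_mod_pow2E := per 0%N; have /z2_mod_pow2E := per 1%N.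
  by rewrite add1n fib_eval1 add0n fib_eval0 subr0.
apply/z2_mod_pow2E; case: m => [|m]; first by rewrite add0n fib_eval0 subr0.
have -> : fib_eval (m.+1 + e) s - fib_eval m.+1 s =
    fib_eval m.+1 s * (fib_eval e.+1 s - 1) + fib_eval m s * fib_eval e s.
  by rewrite addSn fib_eval_add; ring.
by apply: pow2_dvdD; apply: pow2_dvdMl.
Qed.

(** * Odd arguments *)

(** Induction by doubling.  The square of F_(n+1) = 1 + 2^(l+2) (1 + 2b) is
    1 + 2^(l+3) (1 + 2b) + 2^(2l+4) (1 + 2b)^2, and its last term, as well as
    F_n^2, vanishes modulo 2^(l+4); the exponent 2l+4 is large enough only when
    starting from 6 rather than 3. *)
Lemma fib_odd_6pow2 s l : z2_odd s ->
  z2_congr l.+3 (fib_eval (3 * 2 ^ l.+1) s) 0 /\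
  z2_congr l.+3 (fib_eval (3 * 2 ^ l.+1).+1 s) (1 + 2 ^+ l.+2).
Proof.
move=> s_odd; rewrite /z2_congr subr0; elim: l => [|l [[a Fa] [b Fb]]].
  (* F_6 = s (s^2 + 1) (s^2 + 3) and F_7 = s^6 + 5 s^4 + 6 s^2 + 1. *)
  have [c sc] := odd_sqr s_odd.
  rewrite (_ : 3 * 2 ^ 1 = 6)%N // !fib_evalSS fib_eval1 fib_eval0; split.
    exists (s * (1 + 4 * c) * (1 + 2 * c)).
    transitivity (s * (s ^+ 2 + 1) * (s ^+ 2 + 3)); first by ring.
    by rewrite sc; ring.
  exists (1 + 19 * c + 64 * c ^+ 2 + 64 * c ^+ 3).
  transitivity ((s ^+ 2) ^+ 3 + 5 * (s ^+ 2) ^+ 2 + 6 * s ^+ 2 - 4); first by ring.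
  by rewrite sc; ring.
rewrite (_ : 3 * 2 ^ l.+2 = 2 * (3 * 2 ^ l.+1))%N; last by rewrite mulnCA -expnS.
rewrite fib_eval_double fib_eval_doubleS.
move: (fib_eval _ s) (fib_eval _.+1 s) Fa Fb => f g -> /eqP.
rewrite subr_eq => /eqP ->; split.
  exists (a * (2 ^+ l.+3 * b + (1 + 2 ^+ l.+2) - s * 2 ^+ l.+2 * a)).
  by rewrite !exprS; ring.
exists (b + 2 ^+ l.+2 * a ^+ 2 + 2 ^+ l * (1 + 2 * b) ^+ 2).
by rewrite !exprS; ring.
Qed.

Lemma fib_odd_3 s : z2_odd s ->
  pow2_dvd 1 (fib_eval 3 s) /\ pow2_dvd 1 (fib_eval 4 s - 1).
Proof.
move=> [t ->]; rewrite !fib_evalSS fib_eval1 fib_eval0; split.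
  by exists (1 + 2 * t + 2 * t ^+ 2); ring.
by exists (1 + 5 * t + 6 * t ^+ 2 + 4 * t ^+ 3); ring.
Qed.

(** For k > 0 the term after index 3 * 2^k is 1 + 2^(k+1) modulo 2^(k+2); for
    k = 0 it is F_3 = s^2 + 1 that fails to vanish modulo 4. *)
Lemma fib_odd_nperiod s k : z2_odd s ->
  ~ (pow2_dvd k.+2 (fib_eval (3 * 2 ^ k) s) /\
     pow2_dvd k.+2 (fib_eval (3 * 2 ^ k).+1 s - 1)).
Proof.
move=> s_odd; case: k => [|k] [].
  have [c sc] := odd_sqr s_odd.
  rewrite muln1 !fib_evalSS fib_eval1 fib_eval0.
  rewrite (_ : s * _ + 1 = 2 ^+ 1 * (1 + 2 * (2 * c))).
    by move=> dv _; apply: pow2_ndvd dv; exists (2 * c).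
  by transitivity (s ^+ 2 + 1); [ring | rewrite sc; ring].
move=> _ dv; have [_ dv'] := fib_odd_6pow2 k s_odd.
have := pow2_dvdD dv (pow2_dvdN dv').
rewrite (_ : _ - 1 - _ = 2 ^+ k.+2 * 1); last by ring.
by apply: pow2_ndvd; exists 0; rewrite mulr0 addr0.
Qed.

Lemma fib_odd_period s k : z2_odd s ->
  pow2_dvd k.+1 (fib_eval (3 * 2 ^ k) s) /\
  pow2_dvd k.+1 (fib_eval (3 * 2 ^ k).+1 s - 1).
Proof.
move=> s_odd; case: k => [|k]; first exact: fib_odd_3.
have [d0 d1] := fib_odd_6pow2 k s_odd; rewrite /z2_congr subr0 in d0.
split; first exact: pow2_dvdW d0.
rewrite (_ : _ - 1 = fib_eval (3 * 2 ^ k.+1).+1 s - (1 + 2 ^+ k.+2)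
                     + 2 ^+ k.+2 * 1); last by ring.
by apply: pow2_dvdD; [exact: pow2_dvdW d1 | exists 1].
Qed.

(** The remainder of e modulo 3 is a period modulo 2; it is not 1 since F_1 = 1
    is odd, nor 2 since F_2 = s is odd. *)
Lemma fib_odd_period_dvd3 s e : z2_odd s ->
  pow2_dvd 1 (fib_eval e s) -> pow2_dvd 1 (fib_eval e.+1 s - 1) -> (3 %| e)%N.
Proof.
move=> s_odd e0 e1.
have /fib_periodP per3 := fib_odd_3 s_odd.
have /fib_periodP pere := conj e0 e1.
have := period_mod per3 pere; rewrite /dvdn.
case: (e %% 3)%N (ltn_pmod e (isT : 0 < 3)%N) => [|[|[|]]] // _ /fib_periodP[].
  by rewrite fib_eval1 => /pow2_dvdE.
rewrite fib_evalSS fib_eval1 fib_eval0 mulr1 addr0 => s_even.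
by case: (@pow2_ndvd 0 s s_odd); rewrite mul1r.
Qed.

(** * Even arguments *)

(** The doubling formulas double the factors 2^(v+k) of F_n and of F_(n+1) - 1,
    up to multiples of 2^(2(v+k)); these are absorbed since
    2(v+k) >= v+k+1 for v > 0. *)
Lemma fib_even_pow2 s v k : (0 < v)%N -> pow2_dvd v s ->
  pow2_dvd (v + k) (fib_eval (2 ^ k.+1) s) /\
  pow2_dvd (v + k) (fib_eval (2 ^ k.+1).+1 s - 1).
Proof.
case: v => // v _ [u su]; elim: k => [|k [[a Fa] [b Fb]]].
  rewrite addn0 expn1 !fib_evalSS fib_eval1 fib_eval0; split.
    by exists u; rewrite su; ring.
  by exists (u * s); rewrite [in LHS]su [in RHS]su; ring.
rewrite expnS fib_eval_double fib_eval_doubleS addnS.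
move: (fib_eval _ s) (fib_eval _.+1 s) Fa Fb => f g -> /eqP.
rewrite subr_eq => /eqP ->; rewrite addSn su; split.
  exists (a * (2 ^+ (v + k).+1 * b + 1 - 2 ^+ v * u * 2 ^+ (v + k).+1 * a)).
  by rewrite !exprS; ring.
exists (b + 2 ^+ (v + k) * (a ^+ 2 + b ^+ 2)).
by rewrite !exprS; ring.
Qed.

(** With s = 2t, F_(2n) = 2 F_n (F_(n+1) - t F_n) where F_n is even and F_(n+1)
    is odd, so doubling the index raises the valuation by exactly one. *)
Lemma fib_even_pow2_ndvd s v k :
  (0 < v)%N -> pow2_dvd v s -> ~ pow2_dvd v.+1 s ->
  ~ pow2_dvd (v + k).+1 (fib_eval (2 ^ k.+1) s).
Proof.
move=> v_gt0 dvd_s ndvd_s; elim: k => [|k IHk].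
  by rewrite addn0 expn1 !fib_evalSS fib_eval1 fib_eval0 mulr1 addr0.
have [[a Fa] [b Fb]] := fib_even_pow2 k v_gt0 dvd_s.
have [t st] : z2_even s.
  by have [z ->] := pow2_dvdW v_gt0 dvd_s; exists z.
rewrite expnS fib_eval_double addnS.
set f := fib_eval _ s in Fa *; set g := fib_eval _ s in Fb *.
have cofactor_odd : z2_odd (g - t * f).
  case: v v_gt0 {dvd_s ndvd_s IHk} Fa Fb => // v _ Fa /eqP.
  rewrite subr_eq => /eqP ->; exists (2 ^+ (v + k) * (b - t * a)).
  by rewrite Fa addSn exprS; ring.
rewrite (_ : f * _ = 2 * (f * (g - t * f))); last by rewrite st; ring.
by move/pow2_dvd_double/(pow2_dvd_oddM cofactor_odd).
Qed.

(** * Congruences and least periods *)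

Theorem proposition2p6 :
  (forall (s : Z2) (l : nat), z2_odd s -> (0 < l)%N ->
     z2_congr (l + 2) (fib_eval (3 * 2 ^ l)%N s) 0 /\
     z2_congr (l + 2) (fib_eval (3 * 2 ^ l + 1)%N s) (1 + 2 ^+ (l + 1))) /\
  (forall (s : Z2) (l : nat), z2_odd s -> (0 < l)%N ->
     periodic_of_period (fun m : nat => z2_mod_pow2 l (fib_eval m s))
       (3 * 2 ^ (l - 1))%N) /\
  (forall (s : Z2) (l : nat), z2_even s -> (0 < l)%N ->
     (le_nu2 l s ->
        periodic_of_period (fun m : nat => z2_mod_pow2 l (fib_eval m s)) 2) /\
     (forall v : nat, nu2 s = Some v -> (v < l)%N ->
        periodic_of_period (fun m : nat => z2_mod_pow2 l (fib_eval m s))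
          (2 ^ (l + 1 - v))%N)).
Proof.
split; last split.
- move=> s [|l] // s_odd _; rewrite addn2 !addn1.
  exact: fib_odd_6pow2.
- move=> s [|l] // s_odd _; rewrite subn1 /=.
  apply: least_periodP; first by rewrite muln_gt0 expn_gt0.
    by apply/fib_periodP; exact: fib_odd_period.
  move=> p p_pr; rewrite Euclid_dvdM // Euclid_dvdX //.
  case/orP=> [|/andP[+ l_gt0]]; rewrite dvdn_prime2 // => /eqP->.
    rewrite mulKn // => /fib_periodP[d0 d1].
    have: (3 %| 2 ^ l)%N.
      by apply: (fib_odd_period_dvd3 s_odd); [move: d0 | move: d1]; exact: pow2_dvdW.
    by rewrite Euclid_dvdX.
  case: l l_gt0 => // k _; rewrite expnS mulnCA mulKn // => /fib_periodP.
  exact: fib_odd_nperiod.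
- move=> s l s_even l_gt0; split=> [l_le|v sv v_lt].
    have dvd_s : pow2_dvd l s.
      move: l_le; rewrite /le_nu2; case E: (nu2 s) => [v|] l_le.
        by have /nu2_Some[dvd_v _] := E; exact: pow2_dvdW dvd_v.
      by have /nu2_None-> := E; exists 0; rewrite mulr0.
    have := fib_even_pow2 0 l_gt0 dvd_s; rewrite addn0 => /fib_periodP per.
    apply: least_periodP => // p p_pr p_dvd.
    have -> : p = 2%N by apply/eqP; rewrite -dvdn_prime2.
    move=> /fib_periodP[]; rewrite fib_eval1 => dv _.
    by have /pow2_dvdE := pow2_dvdW l_gt0 dv.
  have /nu2_Some[dvd_s ndvd_s] := sv.
  have v_gt0 : (0 < v)%N.
    by case: v ndvd_s {sv v_lt dvd_s} => // -[]; case: s_even => t ->; exists t.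
  rewrite -(subnKC v_lt) in l_gt0 *; move: (l - v.+1)%N => k.
  rewrite (_ : v.+1 + k + 1 - v = k.+2)%N; last by lia.
  apply: least_periodP; first by rewrite expn_gt0.
    by apply/fib_periodP; rewrite addSnnS; exact: fib_even_pow2.
  move=> p p_pr; rewrite Euclid_dvdX // dvdn_prime2 // andbT => /eqP->.
  rewrite expnS mulKn // => /fib_periodP[dv _].
  by apply: fib_even_pow2_ndvd dv.
Qed.
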